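(* Let $\zeta>1$ and $\epsilon>0$ be real numbers with $(\zeta+1)\epsilon<1/2$. Then $\varpi_{\epsilon,\zeta}$ is at most countable. If $\zeta$ is not a rational number whose denominator in lowest terms is even, then the same conclusion holds under the weaker assumption $(\zeta+1)\epsilon\leq 1/2$.
   Context: For real $x$, $\Vert x\Vert$ denotes the distance from $x$ to the nearest integer. For real $\zeta>1$ and $\epsilon>0$, let $\varpi_{\epsilon,\zeta}$ be the set of all real $\alpha\neq 0$ such that $\Vert\alpha\zeta^n\Vert\leq\epsilon$ for all integers $n\geq n_0$, for some integer $n_0=n_0(\alpha,\zeta,\epsilon)$. *)

(* Defs.v *)
From HB Require Import structures.
From mathcomp Require Import all_boot all_order all_algebra.
From mathcomp Require Import all_classical all_reals.

Set Implicit Arguments.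
Unset Strict Implicit.
Unset Printing Implicit Defensive.

Import Order.TTheory GRing.Theory Num.Theory.

Local Open Scope classical_set_scope.
Local Open Scope ring_scope.

Definition dist_int (R : realType) (x : R) : R :=
  inf [set `|x - m%:~R| | m in [set: int]].

(* The exponent ranges over [int], so [zeta ^ n] is [exprz] and negative
   thresholds [n0] are allowed. *)
Definition varpi (R : realType) (eps zeta : R) : set R :=
  [set alpha | alpha != 0 /\
     exists n0 : int, forall n : int, n0 <= n ->
       dist_int (alpha * zeta ^ n) <= eps].

(* [denq q] is the positive denominator of [q] in lowest terms. *)
Definition rational_even_denominator (R : realType) (x : R) : Prop :=
  exists q : rat, x = ratr q /\ (2 %| denq q)%Z.

(* Main.v *)
Require Import Defs.
From mathcomp Require Import all_boot all_order all_algebra.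
From mathcomp Require Import all_classical all_reals.
From mathcomp Require Import lra ring.

Set Implicit Arguments.
Unset Strict Implicit.

Import Order.TTheory GRing.Theory Num.Theory.
Local Open Scope classical_set_scope.
Local Open Scope ring_scope.

(* Write [N_n] for the integer nearest to [alpha * zeta ^ n]. From some index on,
   [N_(n+1) - zeta * N_n] is at most [(zeta + 1) * eps] in absolute value. If
   this bound is below [1/2], then [N_n] determines [N_(n+1)]; if it equals
   [1/2], the only obstruction is that [zeta * N_n] is a half-integer, which
   forces [zeta] to be rational with even denominator. So the threshold [n0] and
   the single integer [N_n0] determine all later [N_n], hence
   [alpha = lim N_n / zeta ^ n], and there are countably many such pairs. *)

Definition nearest_int (R : realType) (x : R) : int := Num.floor (x + 1 / 2).

Lemma norm_nearest_int (R : realType) (x : R) :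
  `|x - (nearest_int x)%:~R| <= 1 / 2.
Proof.
have /andP[] := floor_itv (x + 1 / 2); rewrite -/(nearest_int x) intrD.
by move=> h1 h2; rewrite ler_norml; apply/andP; split; lra.
Qed.

Lemma nearest_intP (R : realType) (x : R) (k : int) :
  `|x - (nearest_int x)%:~R| <= `|x - k%:~R|.
Proof.
have [<-//|neq] := eqVneq (nearest_int x) k.
have h1 := norm_nearest_int x.
have h2 : 1 <= `|(nearest_int x - k)%:~R : R|.
  rewrite -intr_norm -[1]/(1%:~R) ler_int -gtz0_ge1 normr_gt0 subr_eq0.
  exact: neq.
have := ler_distD x (nearest_int x)%:~R k%:~R.
rewrite -intrB distrC; lra.
Qed.

(** The left side is a lower bound of the set whose infimum is [dist_int x]. This trades the infimum
    for one concrete integer. *)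
Lemma nearest_int_dist (R : realType) (x : R) :
  `|x - (nearest_int x)%:~R| <= dist_int x.
Proof.
apply: lb_le_inf; first by exists `|x - 0%:~R|, 0.
by move=> _ [k _ <-]; exact: nearest_intP.
Qed.

Lemma int_approx_unique (R : realType) (x d : R) (a b : int) :
  d < 1 / 2 -> `|a%:~R - x| <= d -> `|b%:~R - x| <= d -> a = b.
Proof.
move=> hd ha hb; apply/eqP; rewrite -subr_eq0 -normr_le0 -ltzD1 add0r.
rewrite -(ltr_int R).
rewrite intr_norm intrB; have := ler_distD x (a%:~R : R) b%:~R.
rewrite (distrC x); lra.
Qed.

(** With [zeta = p / q] in lowest terms, [s * q = 2 * N * p] is even; as [s] is odd, [q] is even. *)
Lemma half_int_multiple (R : realType) (zeta : R) (N s : int) :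
  zeta * (N *+ 2)%:~R = s%:~R -> ~~ (2 %| s)%Z -> rational_even_denominator zeta.
Proof.
move=> e odd_s.
have N0 : N *+ 2 != 0.
  apply: contra odd_s => /eqP N0; move: e; rewrite N0 mulr0 => /esym/eqP.
  by rewrite intr_eq0 => /eqP->; rewrite dvdz0.
have e' : zeta = ratr (s%:~R / (N *+ 2)%:~R).
  by rewrite fmorph_div/= !ratr_int -e mulfK// intr_eq0.
set q : rat := _ / _ in e'; exists q; split=> //.
have : (2 %| s * denq q)%Z.
  suff -> : s * denq q = numq q * N * 2 by rewrite dvdz_mull.
  apply: (@intr_inj rat); rewrite !intrM numqE /q.
  have -> : (N *+ 2)%:~R = N%:~R * 2 :> rat by rewrite -[N *+ 2]mulr_natr intrM.
  field.
  by move: N0; rewrite -[N *+ 2]mulr_natr mulf_eq0 negb_or intr_eq0 => /andP[].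
rewrite Gauss_dvdzr// coprimezE.
by rewrite prime_coprime.
Qed.

(** If [a < b], then [b = a + 1] and [zeta * N] is their midpoint, so [2 * N * zeta = 2 * a + 1] is
    odd. *)
Lemma int_approx_mul_unique (R : realType) (zeta : R) (N a b : int) :
  ~ rational_even_denominator zeta ->
  `|a%:~R - zeta * N%:~R| <= 1 / 2 -> `|b%:~R - zeta * N%:~R| <= 1 / 2 -> a = b.
Proof.
move=> hz; wlog ab : a b / a <= b => [wl ha hb|].
  by case/orP: (le_total a b) => h; [|apply: esym]; apply: wl.
rewrite !ler_norml => /andP[a1 a2] /andP[b1 b2].
apply/eqP/negP => /negP nab; have : a + 1 <= b by rewrite lezD1 lt_neqAle nab.
rewrite -(ler_int R) intrD => lab.
have eab : b = a + 1.
  by apply/eqP; rewrite -(eqr_int R) intrD; apply/eqP; lra.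
apply: hz; apply: (@half_int_multiple _ _ N (a * 2 + 1)).
  rewrite -[N *+ 2]mulr_natr !intrD !intrM; lra.
by rewrite rpredDl ?dvdz_mull.
Qed.

Lemma exp_unbounded (R : realType) (z C : R) :
  1 < z -> exists k : nat, C < z ^+ k.
Proof.
(* Bernoulli's inequality; the induction step discards the nonnegative term [(z - 1) ^+ 2 * k]. *)
move=> z1; have bern k : 1 + (z - 1) * k%:R <= z ^+ k.
  elim: k => [|k IH]; first by rewrite mulr0 addr0 expr0.
  have le_zIH : z * (1 + (z - 1) * k%:R) <= z * z ^+ k
    by rewrite ler_pM2l//; lra.
  have sq_ge0 : 0 <= (z - 1) ^+ 2 * k%:R by rewrite mulr_ge0 ?sqr_ge0.
  rewrite exprS -natr1; nra.
exists (Num.bound (C / (z - 1))); apply: lt_le_trans (bern _).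
have := unstable.ltr_bound (C / (z - 1)).
rewrite ltr_pdivrMr ?subr_gt0//; lra.
Qed.

Lemma le_exp_eq0 (R : realType) (z c x : R) :
  1 < z -> (forall k : nat, `|x| * z ^+ k <= c) -> x = 0.
Proof.
move=> z1 hx; apply/eqP/negP => /negP; rewrite -normr_gt0 => x0.
have [k] := exp_unbounded (c / `|x|) z1.
by rewrite ltr_pdivrMr// mulrC ltNge hx.
Qed.

(** The pair [p] holds the threshold and the nearest integer there; the offset [k] is natural to
    allow induction from the threshold. *)
Definition varpi_class (R : realType) (eps zeta : R) (p : int * int) : set R :=
  [set alpha | nearest_int (alpha * zeta ^ p.1) = p.2 /\
    forall k : nat, `|alpha * zeta ^ p.1 * zeta ^+ k -
      (nearest_int (alpha * zeta ^ p.1 * zeta ^+ k))%:~R| <= eps].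

Lemma varpi_class_unique (R : realType) (eps zeta : R) (p : int * int) :
  1 < zeta ->
  (forall N a b : int, `|a%:~R - zeta * N%:~R| <= (zeta + 1) * eps ->
     `|b%:~R - zeta * N%:~R| <= (zeta + 1) * eps -> a = b) ->
  {in varpi_class eps zeta p &, forall alpha beta, alpha = beta}.
Proof.
move=> z1 det alpha beta; rewrite !inE => -[a0 ha] [b0 hb].
have z0 : zeta != 0 by lra.
set x := alpha * _ in a0 ha; set y := beta * _ in b0 hb.
have step (w : R) k : (forall k : nat, `|w * zeta ^+ k -
    (nearest_int (w * zeta ^+ k))%:~R| <= eps) ->
    `|(nearest_int (w * zeta ^+ k.+1))%:~R -
      zeta * (nearest_int (w * zeta ^+ k))%:~R| <= (zeta + 1) * eps.
  (* The difference is the rounding error at [k.+1] minus [zeta] times the one at [k]. *)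
  move=> hw; have := hw k; have := hw k.+1; rewrite exprSr.
  set n1 := (nearest_int (w * (_ * _)))%:~R; set n0 := (nearest_int _)%:~R.
  rewrite mulrA !ler_norml => /andP[? ?] /andP[? ?].
  by apply/andP; split; nra.
have eqN k : nearest_int (x * zeta ^+ k) = nearest_int (y * zeta ^+ k).
  elim: k => [|k IH]; first by rewrite expr0 !mulr1 a0 b0.
  by apply: det (step _ _ ha) _; rewrite IH; exact: step.
(* Both [x * zeta ^+ k] and [y * zeta ^+ k] lie within [eps] of the same integer, so [x - y] scaled
   by [zeta ^+ k] stays bounded. *)
have exy : x - y = 0.
  apply: (@le_exp_eq0 _ zeta (eps + eps)) => // k.
  have zk : 0 <= zeta ^+ k by apply: exprn_ge0; lra.
  rewrite -[X in _ * X](ger0_norm zk) -normrM mulrBl.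
  apply: le_trans (ler_distD (nearest_int (x * zeta ^+ k))%:~R _ _) _.
  by apply: lerD (ha k) _; rewrite distrC eqN.
by apply: (mulIf (expfz_neq0 p.1 z0)); apply/eqP; rewrite -subr_eq0; apply/eqP.
Qed.

(** The second hypothesis is what both cases of the theorem share: each nearest integer determines
    the next. *)
Lemma varpi_countable (R : realType) (eps zeta : R) :
  1 < zeta ->
  (forall N a b : int, `|a%:~R - zeta * N%:~R| <= (zeta + 1) * eps ->
     `|b%:~R - zeta * N%:~R| <= (zeta + 1) * eps -> a = b) ->
  countable (varpi eps zeta).
Proof.
move=> z1 det; have z0 : zeta != 0 by lra.
apply: (@sub_countable _ _ _ (\bigcup_p varpi_class eps zeta p)).
  apply: subset_card_le => alpha [_ [n0 h]].
  exists (n0, nearest_int (alpha * zeta ^ n0)) => //; split=> //= k.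
  apply: le_trans (nearest_int_dist _) _.
  by rewrite -mulrA exprnP -expfzDr//; apply: h; rewrite lerDl.
(* Each class has at most one element, so a constant map is injective on it. *)
apply: bigcup_countable => // p _; apply/countable_injP; exists (fun=> 0%N).
by move=> a b ha hb _; exact: varpi_class_unique z1 det _ _ ha hb.
Qed.

Theorem theorem3p12 (R : realType) (zeta eps : R)
    (hzeta : 1 < zeta) (heps : 0 < eps) :
  ((zeta + 1) * eps < 1 / 2 -> countable (varpi eps zeta)) /\
  (~ rational_even_denominator zeta ->
   (zeta + 1) * eps <= 1 / 2 -> countable (varpi eps zeta)).
Proof.
split=> [lt|odd le]; apply: varpi_countable => // N a b ha hb.
  exact: int_approx_unique lt ha hb.
exact: int_approx_mul_unique odd (le_trans ha le) (le_trans hb le).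
Qed.
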